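(* Let $\theta>0$. For each $N\ge1$ let $H_N(\sigma)$, $\sigma\in\{+1,-1\}^N$, be i.i.d. Poisson random variables with parameter $N\theta$ (all $N$ on one probability space), and let $Z_N(\beta)=\sum_{\sigma\in\{+1,-1\}^N}e^{-\beta H_N(\sigma)}$ for $\beta\ge0$. (a) If $\theta\le\log2$, then almost surely, for $\beta\ge0$, $$\lim_{N\to\infty}\frac1N\log Z_N(\beta)=\log2-\theta+\theta e^{-\beta}.$$ (b) If $\theta>\log2$, let $x_1$ be the least positive solution of $x\left(\log\frac x\theta-1\right)=\log2-\theta$, and let $\beta_0=\log\frac{\theta}{x_1}=\frac{\theta-\log2}{x_1}-1$. Then almost surely $$\lim_{N\to\infty}\frac1N\log Z_N(\beta)=\begin{cases}\log2-\theta+\theta e^{-\beta}&\text{for }0\le\beta\le\beta_0,\\-\beta x_1&\text{for }\beta>\beta_0.\end{cases}$$ *)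

(* Defs.v *)
From HB Require Import structures.
From mathcomp Require Import all_boot all_order all_algebra.
From mathcomp Require Import all_classical all_reals all_analysis.

Set Implicit Arguments.
Unset Strict Implicit.
Unset Printing Implicit Defensive.

Import Order.TTheory GRing.Theory Num.Theory.
Import numFieldNormedType.Exports.

Local Open Scope classical_set_scope.
Local Open Scope ring_scope.

Definition spin : finType := seq_sub [:: 1; -1 : int].

Definition config (N : nat) : finType := {ffun 'I_N -> spin}.

Definition mutually_independent (d d' : measure_display) (T : measurableType d)
    (T' : measurableType d') (R : realType) (P : probability T R)
    (I : finType) (X : I -> {RV P >-> T'}) : Prop :=
  forall (J : {set I}) (A : I -> set T'),
    (forall i, i \in J -> measurable (A i)) ->
    (P (\bigcap_(i in [set` J]) (X i @^-1` A i)) =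
     \prod_(i in J) P (X i @^-1` A i))%E.

(* The second argument of [poisson_prob] is a dummy: the measure does not
   depend on it. *)
Definition poisson_distributed (d : measure_display) (T : measurableType d)
    (R : realType) (P : probability T R) (rate : R) (X : {RV P >-> nat}) : Prop :=
  forall A : set nat, distribution P X A = poisson_prob rate 0%N A.

Definition partition_function (d : measure_display) (T : measurableType d)
    (R : realType) (P : probability T R)
    (H : forall N : nat, config N -> {RV P >-> nat})
    (N : nat) (beta : R) (w : T) : R :=
  \sum_(sigma : config N) expR (- (beta * (H N sigma w)%:R)).

Definition positive_solutions (R : realType) (theta : R) : set R :=
  [set x | 0 < x /\ x * (ln (x / theta) - 1) = ln 2 - theta].

(* Main.v *)
Require Import Defs.
From HB Require Import structures.
From mathcomp Require Import all_boot all_order all_algebra.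
From mathcomp Require Import all_classical all_reals all_analysis.
From mathcomp Require Import measurable_realfun ring lra.

Import Order.TTheory GRing.Theory Num.Theory.
Import numFieldNormedType.Exports.

Local Open Scope classical_set_scope.
Local Open Scope ring_scope.

(** Put psi(b) = ln 2 - theta + theta e^-b, so that e^(N psi(b)) is the mean of
    Z_N(b) (Laplace transform of the Poisson law), and let
    G(s) = ln 2 - theta + theta (1 + s) e^-s be the value at 0 of the tangent
    line to psi at s.

    Upper bound.  Markov's inequality bounds the probability that Z_N(b)
    exceeds e^(N (psi(b) + eps)) by e^(-N eps), so by Borel-Cantelli almost
    surely this eventually fails, for all rational b and all eps of the form
    1/(m+1) at once.  As Z_N is nonincreasing in b and psi is continuous, this
    extends to every real b >= 0 ([ae_free_energy_le]).

    Lower bound.  The mean of Z_N(s) is carried by the energy level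
    k = floor(N theta e^-s), whose expected number of configurations is
    e^(N G(s)) up to a factor polynomial in N: after tilting the Poisson law to
    mean N theta e^-s, k becomes its mode and has at least the inverse of a
    polynomial as its mass.  When G(s) > 0, pairwise independence and a second
    moment estimate show that, off an event of exponentially small
    probability, at least half of the expected number of configurations have
    energy k; their contribution alone gives, for all b simultaneously,
    N^-1 ln Z_N(b) >= G(s) - b theta e^-s - eps, where G(s) - b theta e^-s is
    the tangent line to psi at s, evaluated at b.  By continuity this extends to
    every t such that G > 0 on [0, t) ([ae_free_energy_ge]).

    Conclusion.  If theta <= ln 2 then G > 0 everywhere, and t = b gives the
    matching lower bound psi(b).  If theta > ln 2, then, (1 + s) e^-s being
    decreasing, G vanishes at exactly one point beta0 >= 0, and
    x1 = theta e^-beta0: indeed x = theta e^-s turns the equation for x into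
    G(s) = 0.  For b <= beta0 take t = b again.  For b > beta0 the tangent at
    t = beta0 is the line - b x1, as it vanishes at 0; and the comparison of
    l^p norms Z_N(b) <= Z_N(beta0)^(b / beta0) gives the matching upper bound
    (b / beta0) psi(beta0) = - b x1 ([ln_sum_expR_le]). *)

(** * Second moments and almost sure events *)

(** Chebyshev's inequality: by pairwise independence the variance of the
    number of events that occur is at most its mean #|I| p. *)
Lemma second_moment_lower_tail {d : measure_display} {T : measurableType d}
    {R : realType} (P : probability T R) (I : finType) (A : I -> set T) (p : R) :
  0 < p -> (0 < #|I|)%N ->
  (forall i, measurable (A i)) ->
  (forall i, P (A i) = p%:E) ->
  (forall i j, i != j -> P (A i `&` A j) = (p ^+ 2)%:E) ->
  (P [set w | (\sum_i (\1_(A i) w : R) <= #|I|%:R * p / 2)%R]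
     <= (4 / (#|I|%:R * p))%:E)%E.
Proof.
move=> p0 I0 mA PA PAA.
(* Integrals are taken with respect to the measure underlying P. *)
pose Q : {measure set T -> \bar R} := P.
have PA' i : Q (A i) = p%:E by exact: PA.
have PAA' i j : i != j -> Q (A i `&` A j) = (p ^+ 2)%:E by exact: PAA.
change (Q [set w | (\sum_i (\1_(A i) w : R) <= #|I|%:R * p / 2)%R]
     <= (4 / (#|I|%:R * p))%:E)%E.
set m : R := #|I|%:R.
have m0 : 0 < m by rewrite ltr0n.
have mp0 : 0 < m * p by rewrite mulr_gt0.
pose C w : R := \sum_i \1_(A i) w.
have mC : measurable_fun setT C.
  by apply: measurable_sum => i; exact: measurable_indic.
have C0 w : 0 <= C w by apply: sumr_ge0.
set E := [set w | _].
have mE : measurable E.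
  rewrite -[E]setTI; apply: (measurable_fun_le measurableT mC) => //.
have intC : (\int[Q]_w (C w)%:E = (m * p)%:E)%E.
  under eq_integral do rewrite -sumEFin.
  rewrite ge0_integral_sum //; first last.
    by move=> i; apply/measurable_EFinP; exact: measurable_indic.
  under eq_bigr do rewrite integral_indic// setIT PA'.
  by rewrite sumEFin sumr_const -mulr_natl.
have intC2 : (\int[Q]_w (C w ^+ 2)%:E <= (m * p + m ^+ 2 * p ^+ 2)%:E)%E.
  have -> : (\int[Q]_w (C w ^+ 2)%:E =
             \int[Q]_w (\sum_i \sum_j (\1_(A i `&` A j) w)%:E))%E.
    apply: eq_integral => w _; rewrite expr2 /C mulr_suml -sumEFin.
    apply: eq_bigr => i _; rewrite mulr_sumr -sumEFin.
    by apply: eq_bigr => j _; rewrite indicI.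
  rewrite ge0_integral_sum //; first last.
  - by move=> i w _; apply: sume_ge0 => j _; rewrite lee_fin.
  - move=> i; apply: emeasurable_sum => j; apply/measurable_EFinP.
    exact/measurable_indic/measurableI.
  have inner i : (\int[Q]_w (\sum_j (\1_(A i `&` A j) w)%:E)
      <= (p + m * p ^+ 2)%:E)%E.
    rewrite ge0_integral_sum //; first last.
      by move=> j; apply/measurable_EFinP; exact/measurable_indic/measurableI.
    rewrite (eq_bigr (fun j => Q (A i `&` A j))); last first.
      by move=> j _; rewrite integral_indic ?setIT//; exact: measurableI.
    rewrite (bigD1 i)//= setIid PA' EFinD leeD2l//.
    apply: (@le_trans _ _ (\sum_(j : I) (p ^+ 2)%:E)%E).
      rewrite [leRHS](bigD1 i)//= -[leLHS]add0e.
      apply: leeD; first by rewrite lee_fin exprn_ge0// ltW.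
      by apply: lee_sum => j ji; rewrite PAA'// eq_sym.
    by rewrite sumEFin sumr_const -mulr_natl.
  apply: (le_trans (lee_sum _ (fun i _ => inner i))).
  rewrite sumEFin sumr_const lee_fin -mulr_natl -/m.
  by rewrite le_eqVlt; apply/orP; left; apply/eqP; ring.
(* On E, (m p / 2)^2 <= (C - m p)^2; expanding the square and moving the cross
   term to the left leaves only nonnegative functions to integrate. *)
have key : (((m * p / 2) ^+ 2)%:E * Q E + (2 * (m * p))%:E * (m * p)%:E
   <= (m * p + m ^+ 2 * p ^+ 2)%:E + ((m * p) ^+ 2)%:E)%E.
  rewrite -intC.
  have -> : (((m * p / 2) ^+ 2)%:E * Q E
      = \int[Q]_w (((m * p / 2) ^+ 2)%:E * (\1_E w)%:E))%E.
    rewrite ge0_integralZl_EFin ?exprn_ge0 ?divr_ge0 ?(ltW mp0)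
      ?integral_indic ?setIT//.
    by apply/measurable_EFinP; exact: measurable_indic.
  rewrite -ge0_integralZl_EFin//; first last.
  - by rewrite mulr_ge0// ltW.
  - exact/measurable_EFinP.
  - by move=> w _; rewrite lee_fin.
  rewrite -ge0_integralD//; first last.
  - by apply: measurable_funeM; exact/measurable_EFinP.
  - by move=> w _; rewrite -EFinM lee_fin !mulr_ge0// ltW.
  - apply: measurable_funeM; apply/measurable_EFinP; exact: measurable_indic.
  - by move=> w _; rewrite -EFinM lee_fin mulr_ge0 ?exprn_ge0 ?divr_ge0 ?(ltW mp0).
  apply: (@le_trans _ _ (\int[Q]_w ((C w ^+ 2)%:E + ((m * p) ^+ 2)%:E))%E).
    apply: ge0_le_integral => //.
    - move=> w _; rewrite -!EFinM -EFinD lee_fin addr_ge0// !mulr_ge0//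
        ?exprn_ge0 ?divr_ge0 ?(ltW mp0) ?(ltW m0) ?(ltW p0) //.
    - apply: (@emeasurable_funD _ _ _ _ (fun w => ((m * p / 2) ^+ 2)%:E * (\1_E w)%:E)%E
        (fun w => (2 * (m * p))%:E * (C w)%:E)%E).
        by apply: measurable_funeM; apply/measurable_EFinP; exact: measurable_indic.
      by apply: measurable_funeM; exact/measurable_EFinP.
    - apply/measurable_EFinP.
      by apply: measurable_funD; [exact: measurable_funX|exact: measurable_cst].
    - move=> w _; rewrite -!EFinM -!EFinD lee_fin.
      rewrite indicE; case: (boolP (w \in E)) => [/set_mem|_] /=; last first.
        by have := sqr_ge0 (C w - m * p); nra.
      rewrite /E /= -/(C w) => Cw; have := C0 w; nra.
  rewrite ge0_integralD//; first last.
  - by move=> w _; rewrite lee_fin exprn_ge0// ltW.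
  - by apply/measurable_EFinP; exact: measurable_funX.
  - by move=> w _; rewrite lee_fin sqr_ge0.
  rewrite integral_cst// (_ : Q setT = 1%E) ?mule1 ?leeD2r//.
  exact: probability_setT.
have QEfin : Q E \is a fin_num by exact: fin_num_measure.
move: key; rewrite -(fineK QEfin) -!EFinM -!EFinD !lee_fin => key.
rewrite ler_pdivlMr// -(ler_pM2r mp0).
by move: key; nra.
Qed.

(** The first Borel-Cantelli lemma for events of exponentially small
    probability. *)
Lemma ae_eventually_notin {d : measure_display} {T : measurableType d}
    {R : realType} (P : probability T R) (E : nat -> set T) (K c : R) :
  0 <= K -> 0 < c ->
  (forall n, measurable (E n)) ->
  (forall n, (1 <= n)%N -> (P (E n) <= (K * expR (- (c * n%:R)))%:E)%E) ->
  {ae P, forall w, \forall n \near \oo, ~ E n w}.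
Proof.
move=> K0 c0 mE PE.
(* The bound is only assumed from index 1 on. *)
pose F n := E n.+1.
have mF n : measurable (F n) by exact: mE.
have r1 : `|expR (- c)| < 1.
  by rewrite ger0_norm ?expR_ge0// expR_lt1 oppr_lt0.
exists (lim_sup_set F); split.
- by apply: bigcap_measurable => // k _; apply: bigcup_measurable => j _.
- apply: lim_sup_set_cvg0 => //.
  apply: (@le_lt_trans _ _ (\sum_(0 <= n <oo) (geometric K (expR (- c)) n)%:E)%E).
    apply: lee_nneseries => // n _.
    have h := PE n.+1 isT; apply: (le_trans h).
    rewrite lee_fin /geometric /= -expRM_natr ler_wpM2l// ler_expR mulNr lerN2.
    by rewrite ler_pM2l// ler_nat.
  have := cvg_geometric_series (a := K) r1 => cg.
  rewrite (_ : (\sum_(0 <= n <oo) _)%E = (K / (1 - expR (- c)))%:E) ?ltry//.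
  apply/cvg_lim => //; under eq_fun do rewrite sumEFin.
  by apply: cvg_EFin => //; exact: nearW.
- move=> w /= nw n _; apply: contrapT => h; apply: nw.
  exists n.+1 => // k /= nk Ek; apply: h; exists k.-1.
    by rewrite /= -ltnS prednK//; apply: leq_ltn_trans nk.
  by rewrite /F prednK//; apply: leq_ltn_trans nk.
Qed.

Lemma ae_forall_countable {d : measure_display} {T : measurableType d}
    {R : realType} (P : probability T R) (I : countType) (Q : I -> T -> Prop) :
  (forall i, {ae P, forall w, Q i w}) -> {ae P, forall w, forall i, Q i w}.
Proof.
move=> aeQ.
have := @ae_foralln _ _ _ P
  (fun n w => if unpickle n is Some i then Q i w else True).
have h n : \forall w \ae P, if @unpickle I n is Some i then Q i w else True.
  by case: unpickle => [i|]; [exact: aeQ|exact: aeW].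
move=> /(_ h); apply: filterS => w hw i.
by have := hw (pickle i); rewrite pickleK.
Qed.

(** * Poisson weights *)

(** Exponential change of measure: weighting by e^(- s k) multiplies the
    parameter by e^(- s), up to normalization. *)
Lemma poisson_pmf_tilt {R : realType} (lambda s : R) (k : nat) : 0 < lambda ->
  poisson_pmf lambda k =
    expR (- lambda + lambda * expR (- s) + s * k%:R)
    * poisson_pmf (lambda * expR (- s)) k.
Proof.
move=> l0; have l'0 : 0 < lambda * expR (- s) by rewrite mulr_gt0// expR_gt0.
rewrite /poisson_pmf l0 l'0 exprMn -expRM_natr !expRD mulNr.
rewrite !(expRN (lambda * expR (- s))) !(expRN (s * k%:R)).
have := expR_gt0 (s * k%:R); have := expR_gt0 (lambda * expR (- s)).
move: (expR (s * k%:R)) (expR (lambda * expR (- s))) => a b a0 b0.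
by field; rewrite !gt_eqF// ltr0n fact_gt0.
Qed.

(** After the change of measure the remaining weights sum to one. *)
Lemma poisson_laplace_transform {d : measure_display} {T : measurableType d}
    {R : realType} (P : probability T R) (lambda beta : R) (X : {RV P >-> nat}) :
  0 < lambda -> poisson_distributed lambda X ->
  (\int[P]_w (expR (- (beta * (X w)%:R)))%:E
     = (expR (- lambda + lambda * expR (- beta)))%:E)%E.
Proof.
move=> l0 hX.
have mX : measurable_fun setT X by [].
pose F k := X @^-1` [set k].
have mF k : measurable (F k) by rewrite -[F k]setTI; exact: mX.
have FT : \bigcup_k F k = setT by apply/seteqP; split => // w _; exists (X w).
have mf : measurable_fun [set: T] (fun w => (expR (- (beta * (X w)%:R))) : R).
  by apply: (measurableT_comp (f := fun n : nat => expR (- (beta * n%:R)) : R)).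
transitivity (\int[P]_(w in \bigcup_k F k) (expR (- (beta * (X w)%:R)))%:E)%E.
  by rewrite FT.
rewrite ge0_integral_bigcup//; first last.
- apply/trivIsetP => i j _ _ /eqP ij; apply/seteqP; split => [w []|w []].
  by rewrite /F /= => wi wj; apply: ij; rewrite -wi -wj.
- by rewrite FT; exact/measurable_EFinP.
have l'0 : 0 < lambda * expR (- beta) by rewrite mulr_gt0// expR_gt0.
transitivity (\sum_(0 <= k <oo) ((expR (- lambda + lambda * expR (- beta)))%:E *
   (poisson_pmf (lambda * expR (- beta)) k)%:E))%E.
  apply: eq_eseriesr => k _.
  rewrite (eq_integral (cst (expR (- (beta * k%:R)))%:E)); last first.
    by move=> w /set_mem /= ->.
  rewrite integral_cst//.
  have PF : (P : {measure set T -> \bar R}) (F k) = (poisson_pmf lambda k)%:E.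
    transitivity (poisson_prob lambda 0%N [set k]); first exact: hX.
    by rewrite /poisson_prob l0 esum_set1// lee_fin poisson_pmf_ge0.
  rewrite PF -!EFinM (poisson_pmf_tilt _ beta)// mulrA -expRD.
  by congr (expR _ * _)%:E; ring.
rewrite nneseriesZl; last by move=> k _; rewrite lee_fin poisson_pmf_ge0.
rewrite nneseries_esumT; last by move=> k; rewrite lee_fin poisson_pmf_ge0.
have := probability_setT (poisson_prob (lambda * expR (- beta)) 0%N).
by rewrite /= /poisson_prob l'0 => ->; rewrite mule1.
Qed.

(** A crude form of Stirling's bound; the induction step is
    (1 - 1/n)^n <= 1/e at n = k + 2. *)
Lemma factorial_le_expn {R : realType} (k : nat) :
  k`!%:R <= (k.+1%:R : R) ^+ k.+1 * expR (- k%:R).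
Proof.
elim: k => [|k IH]; first by rewrite fact0 expr1 oppr0 expR0 mulr1.
rewrite factS natrM.
apply: (@le_trans _ _ ((k.+1%:R : R) ^+ k.+2 * expR (- k%:R))).
  by rewrite exprS -mulrA ler_wpM2l.
have -> : - k.+1%:R = -1 + - k%:R :> R by rewrite -natr1; ring.
rewrite expRD mulrA ler_wpM2r ?expR_ge0//.
have n0 : 0 < k.+2%:R :> R by [].
have h : 1 - k.+2%:R^-1 <= expR (- k.+2%:R^-1) :> R by exact: expR_ge1Dx.
have -> : expR (-1) = expR (- k.+2%:R^-1) ^+ k.+2 :> R.
  by rewrite -expRM_natr mulNr mulVf// gt_eqF.
rewrite -exprMn lerXn2r ?nnegrE ?mulr_ge0 ?expR_ge0//.
apply: le_trans (ler_wpM2l (ltW n0) h).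
by rewrite mulrBr mulr1 mulfV ?gt_eqF// -[k.+2%:R]natr1 addrK.
Qed.

(** The weight at the floor k of the mean mu is at least the inverse of a
    polynomial, so it does not affect exponential rates: in the bound
    k! <= (k + 1)^(k + 1) e^-k, replacing (k + 1)^(k + 1) by mu^k costs a factor
    of at most (1 + mu) (1 + 1 / mu)^k <= (1 + mu) e, and replacing e^-k by
    e^-mu a factor of at most e. *)
Lemma poisson_pmf_mode_ge {R : realType} (mu : R) (k : nat) :
  0 < mu -> k%:R <= mu -> mu < k.+1%:R ->
  expR (- 2) / (1 + mu) <= poisson_pmf mu k.
Proof.
move=> mu0 kmu muk; rewrite /poisson_pmf mu0.
have f0 : 0 < k`!%:R :> R by rewrite ltr0n fact_gt0.
have m1 : 0 < 1 + mu by rewrite addr_gt0.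
have pow : (k.+1%:R : R) ^+ k <= mu ^+ k * expR 1.
  apply: (@le_trans _ _ ((mu * expR mu^-1) ^+ k)).
    rewrite lerXn2r ?nnegrE ?mulr_ge0 ?expR_ge0 ?(ltW mu0)//.
    apply: (@le_trans _ _ (mu * (1 + mu^-1))).
      by rewrite mulrDr mulr1 mulfV ?gt_eqF// -natr1 lerD2r.
    by rewrite ler_pM2l// expR_ge1Dx.
  rewrite exprMn -expRM_natr ler_pM2l ?exprn_gt0// ler_expR.
  by rewrite mulrC ler_pdivrMr// mul1r.
have key : k`!%:R <= (1 + mu) * (mu ^+ k * expR 1) * expR (1 - mu).
  apply: (le_trans (factorial_le_expn k)).
  apply: ler_pM => //; rewrite ?exprn_ge0 ?expR_ge0//.
    rewrite exprS; apply: ler_pM => //; first by rewrite -natr1 addrC lerD2l.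
  by rewrite ler_expR; move: muk; rewrite -natr1; lra.
rewrite ler_pdivrMr// mulrAC mulrAC -(ler_pM2r f0).
have -> : mu ^+ k / k`!%:R * expR (- mu) * (1 + mu) * k`!%:R
   = mu ^+ k * expR (- mu) * (1 + mu) by field; rewrite gt_eqF.
apply: (le_trans (ler_wpM2l (expR_ge0 _) key)).
rewrite le_eqVlt; apply/orP; left; apply/eqP.
rewrite [RHS](_ : _ = mu ^+ k * (1 + mu) * expR (- mu)); last by ring.
have -> : expR (- mu) = expR (- 2) * expR 1 * expR (1 - mu) :> R.
  by rewrite -!expRD; congr expR; ring.
ring.
Qed.

(** * The annealed free energy and its tangent lines *)

(** The exponential growth rate of the mean of the partition function. *)
Definition annealed {R : realType} (theta beta : R) : R :=
  ln 2 - theta + theta * expR (- beta).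

(** The tangent line at s, as - theta e^(-s) is the derivative of
    [annealed theta]. *)
Definition annealed_tangent {R : realType} (theta s beta : R) : R :=
  annealed theta s + theta * expR (- s) * (s - beta).

Lemma annealed_tangent_diag {R : realType} (theta beta : R) :
  annealed_tangent theta beta beta = annealed theta beta.
Proof. by rewrite /annealed_tangent subrr mulr0 addr0. Qed.

Lemma expRN_variation {R : realType} (q t : R) : 0 <= q -> q <= t ->
  0 <= expR (- q) - expR (- t) <= t - q.
Proof.
move=> q0 qt; rewrite subr_ge0 ler_expR lerN2 qt/=.
have -> : expR (- t) = expR (- q) * expR (- (t - q)).
  by rewrite -expRD; congr expR; ring.
have h1 := expR_ge1Dx (- (t - q)).
have h2 : expR (- q) <= 1 by rewrite expR_le1 oppr_le0.
have h3 := expR_gt0 (- q).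
move: h1 h2 h3; move: (expR (- q)) (expR (- (t - q))) => a b.
nra.
Qed.

Lemma annealed_variation {R : realType} (theta q t : R) :
  0 < theta -> 0 <= q -> q <= t ->
  annealed theta q <= annealed theta t + theta * (t - q).
Proof.
move=> th0 q0 qt; have /andP[_] := expRN_variation q t q0 qt.
by rewrite /annealed; nra.
Qed.

Lemma annealed_tangent_variation {R : realType} (theta q t beta : R) :
  0 < theta -> 0 <= q -> q <= t -> 0 <= beta ->
  annealed_tangent theta t beta <=
  annealed_tangent theta q beta + theta * (1 + beta) * (t - q).
Proof.
move=> th0 q0 qt b0; have /andP[] := expRN_variation q t q0 qt.
have : expR (- t) <= 1 by rewrite expR_le1 oppr_le0 (le_trans q0).
rewrite /annealed_tangent /annealed.
move: (expR (- q)) (expR (- t)) => a b b1 ab0 abd.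
rewrite -subr_ge0.
rewrite (_ : _ - _ = theta * ((1 + q) * (a - b) + (1 - b) * (t - q)
  + beta * (t - q - (a - b)))); last by ring.
rewrite mulr_ge0 ?(ltW th0)// !addr_ge0 ?mulr_ge0//; move: ab0 abd; lra.
Qed.

(** The zero of [annealed_tangent theta ^~ 0] is unique because of this
    monotonicity: 1 + t <= (1 + s) (1 + t - s) < (1 + s) e^(t - s). *)
Lemma lt_onePexpRN {R : realType} (s t : R) : 0 <= s -> s < t ->
  (1 + t) * expR (- t) < (1 + s) * expR (- s).
Proof.
move=> s0 st.
have -> : expR (- s) = expR (- t) * expR (t - s).
  by rewrite -expRD; congr expR; ring.
have h : 1 + (t - s) < expR (t - s) by rewrite expR_gt1Dx// subr_eq0 gt_eqF.
rewrite [ltRHS]mulrCA [ltLHS]mulrC ltr_pM2l ?expR_gt0//.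
by apply: (@le_lt_trans _ _ ((1 + s) * (1 + (t - s)))); [|rewrite ltr_pM2l]; nra.
Qed.

Lemma exists_onePexpRN_eq {R : realType} (c : R) : 0 < c -> c <= 1 ->
  exists2 s, 0 <= s & (1 + s) * expR (- s) = c.
Proof.
move=> c0 c1.
pose f (s : R) := (1 + s) * expR (- s).
have S0 : 0 <= 4 / c by rewrite divr_ge0// ltW.
have f0 : f 0 = 1 by rewrite /f addr0 oppr0 expR0 mulr1.
(* This holds because e^x >= (1 + x / 2)^2 for x >= 0. *)
have fS : f (4 / c) <= c.
  rewrite /f; set x := 4 / c.
  have cx : c * x = 4 by rewrite /x; field; rewrite gt_eqF.
  have -> : - x = - (x / 2) - (x / 2) by field.
  rewrite expRB expRN.
  have := expR_ge1Dx (x / 2); move: (expR (x / 2)) => e he.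
  have e0 : 0 < e by move: he S0; rewrite -/x; lra.
  rewrite -invfM ler_pdivrMr ?mulr_gt0//.
  apply: (@le_trans _ _ (c * ((1 + x / 2) * (1 + x / 2)))).
    by move: cx; nra.
  by rewrite ler_pM2l// ler_pM//; move: S0; rewrite -/x; lra.
have fcont : {within `[0, 4 / c], continuous f}.
  apply: continuous_subspaceT => s.
  apply: cvgM; first by apply: cvgD; [exact: cvg_cst|exact: cvg_id].
  by apply: continuous_comp; [exact: continuousN|exact: continuous_expR].
have [|s] := IVT S0 fcont (v := c).
  by rewrite f0 ge_min le_max fS c1 orbT.
by rewrite in_itv /= => /andP[s0 _]; exists s.
Qed.

(** The expected number of configurations at the energy level
    floor(N theta e^(-s)) grows at the rate [annealed_tangent theta s 0]: the
    tilt by s contributes the exponent and the level becomes the mode, whose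
    mass is absorbed, together with the rounding error e^s, by K and eps. *)
Lemma expected_occupation_ge {R : realType} (theta s : R) (eps : R) :
  0 < theta -> 0 <= s -> 0 < eps ->
  exists2 K : R, 0 < K & forall N : nat, (1 <= N)%N ->
    expR (N%:R * (annealed_tangent theta s 0 - eps)) <=
    K * (2 ^+ N *
       poisson_pmf (N%:R * theta) (Num.trunc (N%:R * theta * expR (- s)))).
Proof.
move=> th0 s0 e0.
have K1 : 0 < 1 + theta / eps by rewrite addr_gt0// divr_gt0.
exists (expR (2 + s) * (1 + theta / eps)); first by rewrite mulr_gt0 ?expR_gt0.
move=> N N1; set k := Num.trunc _.
have Ngt0 : 0 < N%:R :> R by rewrite ltr0n.
have l0 : 0 < N%:R * theta by rewrite mulr_gt0.
have mu0 : 0 < N%:R * theta * expR (- s) by rewrite mulr_gt0 ?expR_gt0.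
have /andP[kmu muk] := trunc_itv (ltW mu0); rewrite -/k in kmu muk.
have m1 : 0 < 1 + N%:R * theta * expR (- s) by rewrite addr_gt0.
rewrite (poisson_pmf_tilt _ s)//.
have := poisson_pmf_mode_ge _ _ mu0 kmu muk.
set q := poisson_pmf _ _ => hq.
have -> : (2 : R) ^+ N = expR (N%:R * ln 2) by rewrite expRM_natl lnK ?posrE.
rewrite mulrBr expRD.
have hexp : expR (N%:R * annealed_tangent theta s 0) <=
   expR s * (expR (N%:R * ln 2) *
     expR (- (N%:R * theta) + N%:R * theta * expR (- s) + s * k%:R)).
  rewrite -!expRD ler_expR /annealed_tangent /annealed.
  have : s * (N%:R * theta * expR (- s)) <= s * k%:R + s.
    by rewrite (_ : _ + s = s * k.+1%:R) ?ler_wpM2l ?(ltW muk)// -natr1 mulrDr mulr1.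
  by move: (expR (- s)) => e; nra.
have heps : expR (- (N%:R * eps)) <= (1 + theta / eps) * expR 2 * q.
  apply: (@le_trans _ _ ((1 + theta / eps) / (1 + N%:R * theta * expR (- s)))).
    rewrite expRN -[leRHS]invf_div lef_pV2 ?posrE ?expR_gt0 ?divr_gt0//.
    rewrite ler_pdivrMr//.
    apply: (@le_trans _ _ ((1 + N%:R * eps) * (1 + theta / eps))); last first.
      by rewrite ler_wpM2r ?(ltW K1)// expR_ge1Dx.
    apply: (@le_trans _ _ (1 + N%:R * theta)).
      by rewrite lerD2l ler_piMr ?(ltW l0)// expR_le1 oppr_le0.
    have -> : (1 + N%:R * eps) * (1 + theta / eps) =
       1 + N%:R * theta + (N%:R * eps + theta / eps) by field; rewrite gt_eqF.
    by rewrite lerDl addr_ge0 ?divr_ge0 ?mulr_ge0 ?(ltW e0) ?(ltW th0).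
  rewrite -[leRHS]mulrA ler_pM2l//.
  have -> : (1 + N%:R * theta * expR (- s))^-1 =
      expR 2 * (expR (- 2) / (1 + N%:R * theta * expR (- s))).
    by rewrite mulrA -expRD subrr expR0 mul1r.
  by rewrite ler_wpM2l ?expR_ge0.
apply: (le_trans (ler_pM (expR_ge0 _) (expR_ge0 _) hexp heps)).
by rewrite le_eqVlt; apply/orP; left; apply/eqP; rewrite (expRD 2); ring.
Qed.

(** * Elementary comparisons *)

(** The approximating rational is strictly below t whenever t > 0, so that at
    the critical temperature it stays in the range where the tangent line is
    positive at 0; for t = 0 it is 0. *)
Lemma rat_from_below {R : realType} (t delta : R) : 0 <= t -> 0 < delta ->
  exists q : rat, [/\ 0 <= ratr q :> R, ratr q <= t, t - ratr q <= delta &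
                      0 < t -> ratr q < t].
Proof.
move=> t0 d0; have [tgt0|] := ltP 0 t.
  have [q] : exists q : rat, ratr q \in `](Num.max 0 (t - delta)), t[.
    by apply: rat_in_itvoo; rewrite gt_max tgt0 gtrBl.
  rewrite in_itv/= gt_max => /andP[/andP[q0 qd] qt].
  by exists q; split=> //; [exact: ltW|exact: ltW|move: qd; lra].
move=> t0'; exists 0; rewrite rmorph0; split => //; lra.
Qed.

Lemma le_invn_ln {R : realType} (N : nat) (z a : R) : (0 < N)%N -> 0 < z ->
  (N%:R^-1 * ln z <= a) = (z <= expR (N%:R * a)).
Proof.
by move=> N0 z0; rewrite ler_pdivrMl ?ltr0n// -[in RHS](lnK (x := z)) ?posrE// ler_expR.
Qed.

Lemma ge_invn_ln {R : realType} (N : nat) (z a : R) : (0 < N)%N -> 0 < z ->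
  (a <= N%:R^-1 * ln z) = (expR (N%:R * a) <= z).
Proof.
by move=> N0 z0; rewrite ler_pdivlMl ?ltr0n// -[in RHS](lnK (x := z)) ?posrE// ler_expR.
Qed.

(** Comparison of l^p norms: each term of the sum at b0 is at most the whole
    sum Z0, hence e^(- b h) <= e^(- b0 h) Z0^(b / b0 - 1). *)
Lemma ln_sum_expR_le {R : realType} (I : finType) (h : I -> R) (b0 b : R) :
  (0 < #|I|)%N -> 0 < b0 -> b0 <= b ->
  ln (\sum_i expR (- (b * h i))) <= b / b0 * ln (\sum_i expR (- (b0 * h i))).
Proof.
move=> /card_gt0P[i0 _] b00 b0b.
have Zpos (c : R) : 0 < \sum_i expR (- (c * h i)).
  rewrite (bigD1 i0)//= ltr_pwDl ?expR_gt0//.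
  by apply: sumr_ge0 => i _; exact: expR_ge0.
set Z0 := \sum_i expR (- (b0 * h i)).
have Z00 : 0 < Z0 by exact: Zpos.
have hle i : - (b0 * h i) <= ln Z0.
  rewrite -ler_expR lnK ?posrE// /Z0 (bigD1 i)//= lerDl.
  by apply: sumr_ge0 => j _; exact: expR_ge0.
rewrite -ler_expR lnK ?posrE//.
apply: (@le_trans _ _ (\sum_i expR (- (b0 * h i)) * expR ((b / b0 - 1) * ln Z0))).
  apply: ler_sum => i _; rewrite -expRD ler_expR.
  have c0 : 0 <= b / b0 - 1 by rewrite subr_ge0 ler_pdivlMr// mul1r.
  have := ler_wpM2l c0 (hle i).
  rewrite (_ : - (b * h i) = - (b0 * h i) + (b / b0 - 1) * - (b0 * h i)) ?lerD2l//.
  by field; rewrite gt_eqF.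
rewrite -mulr_suml -/Z0 -[X in X * _](lnK (x := Z0)) ?posrE// -expRD ler_expR.
by rewrite le_eqVlt; apply/orP; left; apply/eqP; ring.
Qed.

(** * Almost sure bounds on the partition function *)

Lemma card_config (N : nat) : #|config N| = (2 ^ N)%N.
Proof. by rewrite card_ffun card_ord card_seq_sub. Qed.

Section poisson_energies.
Context {d : measure_display} {T : measurableType d} {R : realType}.
Context (P : probability T R) (theta : R) (theta_gt0 : 0 < theta).
Context (H : forall N : nat, config N -> {RV P >-> nat}).
Context (H_poisson : forall N : nat, (1 <= N)%N -> forall sigma : config N,
  poisson_distributed (N%:R * theta) (H N sigma)).
Context (H_indep : forall N : nat, (1 <= N)%N -> mutually_independent (H N)).

Lemma measurable_partition_function (N : nat) (beta : R) :
  measurable_fun [set: T] (partition_function H N beta).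
Proof.
apply: measurable_sum => sigma.
exact: (measurableT_comp (f := fun n : nat => expR (- (beta * n%:R)) : R)).
Qed.

Lemma partition_function_gt0 (N : nat) (beta : R) (w : T) :
  0 < partition_function H N beta w.
Proof.
have : (0 < #|config N|)%N by rewrite card_config expn_gt0.
case/card_gt0P => sigma _.
rewrite /partition_function (bigD1 sigma)//= ltr_pwDl ?expR_gt0//.
by apply: sumr_ge0 => i _; exact: expR_ge0.
Qed.

Lemma expectation_partition_function (N : nat) (beta : R) : (1 <= N)%N ->
  (\int[P]_w (partition_function H N beta w)%:E
     = (expR (N%:R * annealed theta beta))%:E)%E.
Proof.
move=> N1; rewrite /partition_function.
under eq_integral do rewrite -sumEFin.
rewrite ge0_integral_sum //; first last.
  move=> sigma; apply/measurable_EFinP.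
  exact: (measurableT_comp (f := fun n : nat => expR (- (beta * n%:R)) : R)).
rewrite (eq_bigr (fun=> (expR (- (N%:R * theta) +
    N%:R * theta * expR (- beta)))%:E)); last first.
  move=> sigma _; apply: poisson_laplace_transform; last exact: H_poisson.
  by rewrite mulr_gt0// ltr0n.
rewrite sumEFin sumr_const card_config -(mulr_natl _ (2 ^ N)%N) natrX; congr EFin.
have -> : (2 : R) ^+ N = expR (N%:R * ln 2) by rewrite expRM_natl lnK ?posrE.
by rewrite -expRD; congr expR; rewrite /annealed; ring.
Qed.

(** Markov's inequality: the exceptional event has probability at most
    e^(- eps N). *)
Lemma ae_partition_function_le (beta eps : R) : 0 < eps ->
  {ae P, forall w, \forall N \near \oo,
     partition_function H N beta w <= expR (N%:R * (annealed theta beta + eps))}.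
Proof.
move=> e0.
pose E N := [set w | expR (N%:R * (annealed theta beta + eps)) <=
                     partition_function H N beta w].
have mE N : measurable (E N).
  rewrite -[E N]setTI; apply: (measurable_fun_le measurableT) => //.
  exact: measurable_partition_function.
have PE N : (1 <= N)%N -> (P (E N) <= (1 * expR (- (eps * N%:R)))%:E)%E.
  move=> N1; set a := expR (N%:R * (annealed theta beta + eps)).
  have a0 : 0 < a by exact: expR_gt0.
  have : (a%:E * P (E N) <= (expR (N%:R * annealed theta beta))%:E)%E.
    rewrite -expectation_partition_function//.
    rewrite (_ : P (E N) = \int[P]_w (\1_(E N) w)%:E)%E; last first.
      by rewrite integral_indic// setIT.
    rewrite -ge0_integralZl_EFin ?(ltW a0)//; last first.
      by apply/measurable_EFinP; exact: measurable_indic.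
    apply: ge0_le_integral => //.
    - by move=> w _; rewrite -EFinM lee_fin mulr_ge0// ltW.
    - by apply: measurable_funeM; apply/measurable_EFinP; exact: measurable_indic.
    - by apply/measurable_EFinP; exact: measurable_partition_function.
    - move=> w _; rewrite -EFinM lee_fin indicE.
      case: (boolP (w \in E N)) => [/set_mem|_]; first by rewrite mulr1.
      by rewrite mulr0 ltW// partition_function_gt0.
  have PEfin : P (E N) \is a fin_num by exact: fin_num_measure.
  rewrite -(fineK PEfin) -EFinM !lee_fin mul1r => h.
  rewrite -(ler_pM2l a0) (le_trans h)// -expRD ler_expR.
  by rewrite le_eqVlt; apply/orP; left; apply/eqP; ring.
have := ae_eventually_notin P E 1 eps ler01 e0 mE PE.
apply: filterS => w; apply: filterS => N.
by rewrite /E /= => /negP; rewrite -ltNge => /ltW.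
Qed.

(** A positive tangent value at 0 makes the expected number of configurations
    at level floor(N theta e^(-s)) exponentially large, hence at least half of
    it is attained.  The exceptional set comes before beta because the event
    concerns that number alone. *)
Lemma ae_partition_function_ge (s eps : R) : 0 <= s -> 0 < eps ->
  0 < annealed_tangent theta s 0 ->
  {ae P, forall w, \forall N \near \oo, forall beta : R, 0 <= beta ->
     expR (N%:R * (annealed_tangent theta s beta - eps)) <=
     partition_function H N beta w}.
Proof.
move=> s0 e0 G0.
set G := annealed_tangent theta s 0.
(* Half of G keeps the probabilities summable, half of eps keeps room for the
   constant 2 K. *)
pose e : R := Num.min (G / 2) (eps / 2).
have ege0 : 0 < e by rewrite lt_min !divr_gt0.
have eG : e <= G / 2 by rewrite ge_min lexx.
have eeps : e <= eps / 2 by rewrite ge_min lexx orbT.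
have [K K0 hK] := expected_occupation_ge _ _ _ theta_gt0 s0 ege0.
rewrite -/G in hK.
pose k N := Num.trunc (N%:R * theta * expR (- s)).
pose p N := poisson_pmf (N%:R * theta) (k N).
pose A N (sigma : config N) := H N sigma @^-1` [set k N].
pose C N w : R := \sum_sigma \1_(A N sigma) w.
pose E N := [set w | C N w <= #|config N|%:R * p N / 2].
have mA N sigma : measurable (A N sigma).
  rewrite -[A N sigma]setTI.
  have : measurable_fun setT (H N sigma) by [].
  exact.
have mC N : measurable_fun setT (C N).
  by apply: measurable_sum => sigma; exact: measurable_indic.
have mE N : measurable (E N).
  by rewrite -[E N]setTI; apply: (measurable_fun_le measurableT).
have card0 N : (0 < #|config N|)%N by rewrite card_config expn_gt0.
have p0 N : (1 <= N)%N -> 0 < p N.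
  move=> N1; have l0 : 0 < N%:R * theta by rewrite mulr_gt0 ?ltr0n.
  by rewrite /p /poisson_pmf l0 !mulr_gt0 ?exprn_gt0 ?expR_gt0// invr_gt0 ltr0n fact_gt0.
have PA N (N1 : (1 <= N)%N) sigma : P (A N sigma) = (p N)%:E.
  have l0 : 0 < N%:R * theta by rewrite mulr_gt0 ?ltr0n.
  transitivity (poisson_prob (N%:R * theta) 0%N [set k N]); first exact: H_poisson.
  by rewrite /poisson_prob l0 esum_set1// lee_fin poisson_pmf_ge0.
have PAA N (N1 : (1 <= N)%N) sigma tau : sigma != tau ->
    P (A N sigma `&` A N tau) = (p N ^+ 2)%:E.
  move=> st.
  have := H_indep N N1 [set sigma; tau]%SET (fun=> [set k N]) (fun _ _ => I).
  rewrite (big_setD1 sigma) ?set21//= (_ : _ :\ _ = [set tau]%SET); last first.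
    by apply/setP => x; rewrite !inE; case: (eqVneq x sigma) => //= ->; rewrite (negbTE st).
  rewrite big_set1 -[in RHS]/(A N sigma) -[in RHS]/(A N tau) !PA// -EFinM => <-.
  congr (P _); apply/seteqP; split => [w [ws wt] i /=|w h].
    by rewrite !inE => /orP[] /eqP ->.
  by split; [apply: (h sigma)|apply: (h tau)]; rewrite /= !inE eqxx ?orbT.
have PE N : (1 <= N)%N -> (P (E N) <= (4 * K * expR (- (G / 2 * N%:R)))%:E)%E.
  move=> N1.
  have := second_moment_lower_tail P (config N) (A N) (p N) (p0 N N1) (card0 N)
    (mA N) (PA N N1) (PAA N N1).
  move/le_trans; apply; rewrite lee_fin -mulrA ler_pM2l//.
  have := hK N N1; rewrite -/(p N) -natrX -card_config => h.
  have q0 : 0 < #|config N|%:R * p N by rewrite mulr_gt0 ?p0// ltr0n.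
  rewrite expRN ler_pdivlMr ?expR_gt0// mulrC ler_pdivrMr//.
  apply: le_trans h; rewrite ler_expR.
  by rewrite mulrC ler_wpM2l//; move: eG; lra.
have := ae_eventually_notin P E (4 * K) (G / 2) _ _ mE PE.
have -> : 0 <= 4 * K by rewrite mulr_ge0// ltW.
have -> : 0 < G / 2 by rewrite divr_gt0.
move=> /(_ isT isT); apply: filterS => w hw.
near=> N => beta b0.
have N1 : (1 <= N)%N by near: N; exact: nbhs_infty_ge.
have NE : ~ E N w by near: N; exact: hw.
have NK : ln (2 * K) <= N%:R * (eps / 2).
  rewrite -ler_pdivrMr ?divr_gt0//; near: N; exact: nbhs_infty_ger.
have kmu : (k N)%:R <= N%:R * theta * expR (- s).
  have mu0 : 0 <= N%:R * theta * expR (- s).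
    by rewrite !mulr_ge0 ?expR_ge0 ?(ltW theta_gt0).
  by have /andP[] := trunc_itv mu0.
have ZC : expR (- (beta * (k N)%:R)) * C N w <= partition_function H N beta w.
  rewrite /C mulr_sumr; apply: ler_sum => sigma _; rewrite indicE.
  case: (boolP (w \in A N sigma)) => [/set_mem|_]; last by rewrite mulr0 expR_ge0.
  by rewrite /A /= => ->; rewrite mulr1.
apply: le_trans ZC.
have {NE}/ltW CE : #|config N|%:R * p N / 2 < C N w.
  by rewrite ltNge; apply/negP.
have := hK N N1; rewrite -/(p N) -natrX -card_config => h.
have hq : expR (N%:R * (G - e)) <= 2 * K * C N w.
  apply: (le_trans h).
  rewrite [leLHS](_ : _ = 2 * K * (#|config N|%:R * p N / 2)); last by field.
  by rewrite ler_wpM2l ?mulr_ge0 ?(ltW K0).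
have K20 : 0 < 2 * K by rewrite mulr_gt0.
rewrite -(ler_pM2l K20) mulrCA.
have -> : 2 * K = expR (ln (2 * K)) by rewrite lnK ?posrE.
apply: (@le_trans _ _ (expR (- (beta * (k N)%:R)) * expR (N%:R * (G - e)))); last first.
  by rewrite ler_wpM2l ?expR_ge0// lnK ?posrE.
rewrite -!expRD ler_expR.
have bk : beta * (k N)%:R <= beta * (N%:R * theta * expR (- s)) by rewrite ler_wpM2l.
have Ne : N%:R * e <= N%:R * (eps / 2) by rewrite ler_wpM2l.
move: bk Ne NK; rewrite /G /annealed_tangent; set x := expR (- s).
move: (ln (2 * K)) (annealed theta s) => l a; nra.
Unshelve. all: by end_near.
Qed.


(** Countably many rational temperatures suffice: the partition function
    decreases with beta, so a rational q slightly below beta gives an upper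
    bound at beta. *)
Lemma ae_free_energy_le :
  {ae P, forall w, forall beta eps : R, 0 <= beta -> 0 < eps ->
     \forall N \near \oo,
       N%:R^-1 * ln (partition_function H N beta w) <= annealed theta beta + eps}.
Proof.
have := ae_forall_countable P (rat * nat)%type (fun qm w => \forall N \near \oo,
  partition_function H N (ratr qm.1) w <=
    expR (N%:R * (annealed theta (ratr qm.1) + qm.2.+1%:R^-1))).
have h (qm : rat * nat) : {ae P, forall w, \forall N \near \oo,
  partition_function H N (ratr qm.1) w <=
    expR (N%:R * (annealed theta (ratr qm.1) + qm.2.+1%:R^-1))}.
  by apply: ae_partition_function_le; rewrite invr_gt0.
move=> /(_ h); apply: filterS => w hw beta eps b0 e0.
have d0 : 0 < eps / 2 / theta by rewrite !divr_gt0.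
have [q [q0 qb qd _]] := rat_from_below beta _ b0 d0.
have [m] : exists m : nat, m.+1%:R^-1 < eps / 2.
  have /ltr_add_invr[m] : 0 < eps / 2 by rewrite divr_gt0.
  by rewrite add0r; exists m.
move=> me.
have := hw (q, m); apply: filterS2 (nbhs_infty_gt 0) => N N0 /= Zq.
rewrite le_invn_ln ?partition_function_gt0//.
apply: (@le_trans _ _ (partition_function H N (ratr q) w)).
  apply: ler_sum => sigma _; rewrite ler_expR lerN2.
  by rewrite ler_wpM2r.
apply: (le_trans Zq); rewrite ler_expR ler_wpM2l//.
have := annealed_variation theta (ratr q) beta theta_gt0 q0 qb.
have : theta * (beta - ratr q) <= eps / 2.
  by rewrite mulrC -ler_pdivlMr.
by move: me; move: (ratr q) (m.+1%:R^-1) => x y; lra.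
Qed.

(** For t = 0 the hypothesis on s is vacuous, and the approximating
    rational 0 is admissible because its tangent line has value ln 2 > 0 at 0. *)
Lemma ae_free_energy_ge :
  {ae P, forall w, forall t : R, 0 <= t ->
     (forall s, 0 <= s < t -> 0 < annealed_tangent theta s 0) ->
     forall beta eps : R, 0 <= beta -> 0 < eps ->
     \forall N \near \oo,
       annealed_tangent theta t beta - eps <=
       N%:R^-1 * ln (partition_function H N beta w)}.
Proof.
have := ae_forall_countable P (rat * nat)%type (fun qm w =>
  0 <= ratr qm.1 :> R -> 0 < annealed_tangent theta (ratr qm.1) 0 ->
  \forall N \near \oo, forall beta : R, 0 <= beta ->
    expR (N%:R * (annealed_tangent theta (ratr qm.1) beta - qm.2.+1%:R^-1)) <=
    partition_function H N beta w).
have h (qm : rat * nat) : {ae P, forall w,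
  0 <= ratr qm.1 :> R -> 0 < annealed_tangent theta (ratr qm.1) 0 ->
  \forall N \near \oo, forall beta : R, 0 <= beta ->
    expR (N%:R * (annealed_tangent theta (ratr qm.1) beta - qm.2.+1%:R^-1)) <=
    partition_function H N beta w}.
  have [q0|q0] := pselect (0 <= ratr qm.1 :> R); last by apply: aeW => w /q0.
  have [G0|G0] := pselect (0 < annealed_tangent theta (ratr qm.1) 0); last first.
    by apply: aeW => w _ /G0.
  have : 0 < qm.2.+1%:R^-1 :> R by rewrite invr_gt0.
  move=> /(ae_partition_function_ge _ _ q0)/(_ G0).
  by apply: filterS => w hw _ _.
move=> /(_ h); apply: filterS => w hw t t0 Gpos beta eps b0 e0.
have c0 : 0 < theta * (1 + beta) by rewrite mulr_gt0// ltr_pwDl.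
have d0 : 0 < eps / 2 / (theta * (1 + beta)) by rewrite !divr_gt0.
have [q [q0 qt qd qlt]] := rat_from_below t _ t0 d0.
have Gq : 0 < annealed_tangent theta (ratr q) 0.
  have [tgt0|t0'] := ltP 0 t; first by apply: Gpos; rewrite q0 qlt.
  have -> : ratr q = 0 :> R by apply/eqP; rewrite eq_le q0 (le_trans qt).
  rewrite /annealed_tangent /annealed oppr0 expR0 addr0 mulr0 addr0 mulr1 subrK.
  by rewrite ln_gt0// ltr1n.
have [m me] : exists m : nat, m.+1%:R^-1 < eps / 2.
  have /ltr_add_invr[m] : 0 < eps / 2 by rewrite divr_gt0.
  by rewrite add0r; exists m.
have := hw (q, m) q0 Gq.
apply: filterS2 (nbhs_infty_gt 0) => N N0 /= /(_ beta b0) Zq.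
rewrite ge_invn_ln ?partition_function_gt0//.
apply: le_trans Zq; rewrite ler_expR ler_wpM2l//.
have := annealed_tangent_variation theta (ratr q) t beta theta_gt0 q0 qt b0.
have : theta * (1 + beta) * (t - ratr q) <= eps / 2.
  by rewrite mulrC -ler_pdivlMr.
by move: me; move: (ratr q) (m.+1%:R^-1) => x y; lra.
Qed.

End poisson_energies.

(** * The limiting free energy *)

Theorem theorem1p5p2 (R : realType) (d : measure_display) (T : measurableType d)
    (P : probability T R) (theta : R) (theta_gt0 : 0 < theta)
    (H : forall N : nat, config N -> {RV P >-> nat})
    (H_poisson : forall N : nat, (1 <= N)%N -> forall sigma : config N,
       poisson_distributed (N%:R * theta) (H N sigma))
    (H_indep : forall N : nat, (1 <= N)%N -> mutually_independent (H N)) :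
  (theta <= ln 2 ->
     {ae P, forall w : T, forall beta : R, 0 <= beta ->
        (N%:R^-1 * ln (partition_function H N beta w)) @[N --> \oo]
          --> ln 2 - theta + theta * expR (- beta)})
  /\
  (ln 2 < theta ->
     exists x1 : R,
       [/\ positive_solutions theta x1,
           lbound (positive_solutions theta) x1 &
           let beta0 := ln (theta / x1) in
           beta0 = (theta - ln 2) / x1 - 1 /\
           {ae P, forall w : T, forall beta : R, 0 <= beta ->
              (N%:R^-1 * ln (partition_function H N beta w)) @[N --> \oo]
                --> (if beta <= beta0
                     then ln 2 - theta + theta * expR (- beta)
                     else - (beta * x1))}]).
Proof.
have upper := ae_free_energy_le P theta theta_gt0 H H_poisson.
have lower := ae_free_energy_ge P theta theta_gt0 H H_poisson H_indep.
have tangent0 s : annealed_tangent theta s 0 =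
    ln 2 - theta + theta * ((1 + s) * expR (- s)).
  by rewrite /annealed_tangent /annealed; ring.
split=> [theta_le|theta_gt].
  have G0 s : 0 <= s -> 0 < annealed_tangent theta s 0.
    move=> s0; rewrite tangent0 ltr_wpDl ?subr_ge0//.
    by rewrite !mulr_gt0 ?expR_gt0// ltr_pwDl.
  apply: filterS2 upper lower => w up low beta beta0.
  apply/cvgrPdist_le => eps eps0.
  have := low beta beta0 (fun s sb => G0 s (andP sb).1) beta eps beta0 eps0.
  apply: filterS2 (up beta eps beta0 eps0) => N.
  rewrite annealed_tangent_diag /annealed distrC ler_distl => -> ->.
  by [].
have th1 : 0 < (theta - ln 2) / theta by rewrite divr_gt0// subr_gt0.
have [|b b0 bE] := exists_onePexpRN_eq _ th1.
  by rewrite ler_pdivrMr// mul1r gerBl ln_ge0// ler1n.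
have Gb : annealed_tangent theta b 0 = 0.
  by rewrite tangent0 bE; field; rewrite gt_eqF.
have bgt0 : 0 < b.
  rewrite lt_neqAle b0 andbT; apply/eqP => b0E.
  move: Gb; rewrite -b0E tangent0 addr0 oppr0 expR0 !mulr1 subrK => /eqP.
  by rewrite gt_eqF// ln_gt0// ltr1n.
have x0 : 0 < theta * expR (- b) by rewrite mulr_gt0 ?expR_gt0.
(* The change of variable x = theta e^(-s). *)
have critical (s : R) : theta * expR (- s) * (ln (theta * expR (- s) / theta) - 1)
    = ln 2 - theta - annealed_tangent theta s 0.
  by rewrite [_ / theta]mulrAC mulfV ?gt_eqF// mul1r expRK tangent0; ring.
exists (theta * expR (- b)); split.
- by split => //; rewrite critical Gb subr0.
- move=> x [xgt0 xE].
  have xs : x = theta * expR (- ln (theta / x)).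
    rewrite -lnV ?posrE ?divr_gt0// invf_div lnK ?posrE ?divr_gt0//.
    by field; rewrite gt_eqF.
  move: xE; rewrite xs critical => Gs.
  rewrite ler_pM2l// ler_expR lerN2 leNgt; apply/negP => bs.
  have := lt_onePexpRN _ _ b0 bs; rewrite -(ltr_pM2l theta_gt0).
  by move: Gs Gb; rewrite !tangent0; lra.
have bE' : ln (theta / (theta * expR (- b))) = b.
  rewrite invfM mulrA mulfV ?gt_eqF// mul1r -expRN opprK expRK//.
rewrite bE' /=; split.
  move: Gb; rewrite tangent0 => Gb'.
  have -> : theta - ln 2 = (1 + b) * (theta * expR (- b)) by move: Gb'; lra.
  by rewrite mulfK ?gt_eqF// addrC addKr.
apply: filterS2 upper lower => w up low beta beta0.
have G0 s : 0 <= s < b -> 0 < annealed_tangent theta s 0.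
  move=> /andP[s0 sb]; have := lt_onePexpRN _ _ s0 sb.
  rewrite -(ltr_pM2l theta_gt0).
  by move: Gb; rewrite !tangent0; lra.
have annb : annealed theta b = - (b * (theta * expR (- b))).
  by move: Gb; rewrite /annealed_tangent; lra.
apply/cvgrPdist_le => eps eps0.
case: ifPn => [bb|]; last rewrite -ltNge => bb.
  have Gs s : 0 <= s < beta -> 0 < annealed_tangent theta s 0.
    by move=> /andP[s0 sb]; apply: G0; rewrite s0 (lt_le_trans sb).
  have := low beta beta0 Gs beta eps beta0 eps0.
  apply: filterS2 (up beta eps beta0 eps0) => N.
  by rewrite annealed_tangent_diag /annealed distrC ler_distl => -> ->.
have := low b b0 G0 beta eps beta0 eps0.
(* The tolerance is multiplied by beta / b in the comparison below. *)
have e'0 : 0 < eps * (b / beta) by rewrite mulr_gt0// divr_gt0// (lt_trans bgt0).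
apply: filterS2 (up b _ b0 e'0) => N Ub Lb.
rewrite distrC ler_distl; apply/andP; split.
  apply: le_trans Lb; rewrite lerD2r /annealed_tangent annb.
  by rewrite le_eqVlt; apply/orP; left; apply/eqP; ring.
have card0 : (0 < #|config N|)%N by rewrite card_config expn_gt0.
have := ln_sum_expR_le (config N) (fun sigma => (H N sigma w)%:R) b beta
  card0 bgt0 (ltW bb).
rewrite -/(partition_function H N beta w) -/(partition_function H N b w) => Zle.
apply: (@le_trans _ _ (beta / b * (N%:R^-1 * ln (partition_function H N b w)))).
  by rewrite mulrCA ler_wpM2l.
have r0 : 0 <= beta / b by rewrite divr_ge0.
apply: (le_trans (ler_wpM2l r0 Ub)).
rewrite annb le_eqVlt; apply/orP; left; apply/eqP.
by field; rewrite !gt_eqF// (lt_trans bgt0).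
Qed.
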